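(* For every integer $n\ge3$ and every $M\in\{0,\dots,n-1\}$, $$P_n^{\text{av}(213)}\big(W_{\mathcal{S}(n,M)}\big)=P_n^{\text{av}(213)}(\sigma_{M+1}=n).$$ The probability $P_n^{\text{av}(213)}(\sigma_{M+1}=n)$ is non-increasing in $M$, and its maximum occurs for $M\in\{0,1\}$. One has $$P_n^{\text{av}(213)}\big(W_{\mathcal{S}(n,0)}\big)=P_n^{\text{av}(213)}\big(W_{\mathcal{S}(n,1)}\big)=\frac{C_{n-1}}{C_n}=\frac{n+1}{2(2n-1)}.$$ In particular, the optimal probability, that is, $\max_{M\in\{0,\dots,n-1\}}P_n^{\text{av}(213)}(W_{\mathcal{S}(n,M)})$, is decreasing in $n$ and $$\lim_{n\to\infty}P_n^{\text{av}(213)}\big(W_{\mathcal{S}(n,0)}\big)=\lim_{n\to\infty}P_n^{\text{av}(213)}\big(W_{\mathcal{S}(n,1)}\big)=\frac14.$$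
   Context: $S_n$ is the set of permutations $\sigma=\sigma_1\cdots\sigma_n$ of $[n]=\{1,\dots,n\}$. In the secretary problem, $n$ items with ranks $1,\dots,n$ arrive one at a time, $\sigma_i$ being the rank of the $i$th item to arrive; $n$ is the highest rank. The observer sees only the relative ranks of the items that have arrived so far. For $M\in\{0,1,\dots,n-1\}$, the strategy $\mathcal{S}(n,M)$ is: reject the first $M$ items, then select the first later-arriving item whose rank is higher than that of each of the first $M$ items, if such an item exists (for $M=0$, this means the first item is selected). $W_{\mathcal{S}(n,M)}\subset S_n$ is the event that the observer using $\mathcal{S}(n,M)$ selects the item of rank $n$. Pattern avoidance: for $\eta=\eta_1\eta_2\eta_3\in S_3$ and $\sigma\in S_n$, $\sigma$ contains $\eta$ if there are indices $1\le i_1<i_2<i_3\le n$ such that for all $1\le j,k\le 3$, $\sigma_{i_j}<\sigma_{i_k}$ if and only if $\eta_j<\eta_k$; otherwise $\sigma$ avoids $\eta$. $S_n^{\text{av}(\eta)}$ is the set of $\sigma\in S_n$ avoiding $\eta$, and $P_n^{\text{av}(\eta)}$ is the uniform probability measure on $S_n^{\text{av}(\eta)}$. $C_n=\frac{1}{n+1}\binom{2n}{n}$ for $n\ge1$ and $C_0=1$ (Catalan numbers). *)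

(* Defs.v *)
From mathcomp Require Import all_boot all_order all_fingroup all_algebra.
From mathcomp Require Import all_classical all_reals all_analysis.

Set Implicit Arguments.
Unset Strict Implicit.
Unset Printing Implicit Defensive.

Import Order.TTheory GRing.Theory Num.Theory.

(* A permutation sigma = sigma_1 ... sigma_n of {1, ..., n} is an s : 'S_n, with
   positions and ranks both shifted down by one: sigma_(i+1) = (s i) + 1.
   Hence the i-th arrival has index i - 1, the highest rank n is n.-1, and
   position M + 1 has index M. *)

Definition contains_pattern (n : nat) (eta : 'S_3) (s : 'S_n) : bool :=
  [exists f : {ffun 'I_3 -> 'I_n},
    [forall j : 'I_3, forall k : 'I_3, (j < k)%N ==> (f j < f k)%N] &&
    [forall j : 'I_3, forall k : 'I_3,
       (s (f j) < s (f k))%N == (eta j < eta k)%N]].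

Definition avoiders (n : nat) (eta : 'S_3) : {set 'S_n} :=
  [set s : 'S_n | ~~ contains_pattern eta s].

(* The pattern 213 in one-line notation swaps the first two values. *)
Definition pat213 : 'S_3 :=
  tperm (Ordinal (isT : (0 < 3)%N)) (Ordinal (isT : (1 < 3)%N)).

(* The uniform probability measure on the permutations avoiding eta,
   evaluated at the event A. *)
Definition prob_av (R : realType) (n : nat) (eta : 'S_3) (A : {set 'S_n}) : R :=
  (#|avoiders n eta :&: A|%:R / #|avoiders n eta|%:R)%R.

(* The item at position i arrives after the first M items and outranks all of
   them (vacuously so when M = 0). *)
Definition acceptable (n M : nat) (s : 'S_n) (i : 'I_n) : bool :=
  (M <= i)%N && [forall j : 'I_n, (j < M)%N ==> (s j < s i)%N].

Definition selects (n M : nat) (s : 'S_n) (i : 'I_n) : bool :=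
  acceptable M s i && [forall k : 'I_n, (k < i)%N ==> ~~ acceptable M s k].

Definition win (n M : nat) : {set 'S_n} :=
  [set s : 'S_n | [exists i : 'I_n, selects M s i && (nat_of_ord (s i) == n.-1)]].

(* The event sigma_(M+1) = n. *)
Definition top_at (n : nat) (M : 'I_n) : {set 'S_n} :=
  [set s : 'S_n | nat_of_ord (s M) == n.-1].

Definition catalan (R : realType) (n : nat) : R :=
  ('C((2 * n)%N, n)%:R / n.+1%:R)%R.

(* Probabilities are nonnegative, so the default value 0 does not affect the
   maximum over M = 0, ..., n-1. *)
Definition optimal_prob (R : realType) (n : nat) (eta : 'S_3) : R :=
  \big[Num.max/0%R]_(M < n) prob_av R eta (win n M).

(* Main.v *)
Require Import Defs.
From mathcomp Require Import all_boot all_order all_fingroup all_algebra.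
From mathcomp Require Import all_classical all_reals all_analysis.
From mathcomp Require Import zify ring lra.

Set Implicit Arguments.
Unset Strict Implicit.
Unset Printing Implicit Defensive.

Import Order.TTheory GRing.Theory Num.Theory.
Import numFieldNormedType.Exports.


(** In a 213-avoiding permutation the entries to the left of the maximum
    increase, since a descent there together with the maximum is a 213. So if
    the maximum sits at index i > M, the entry at index M already beats the
    first M entries and the strategy selects it instead: the strategy wins
    exactly when the maximum is at index M ([win_top_at]).

    Conversely, inserting a new maximum at index i into an avoider creates a
    213 only through a descent among the first i entries
    ([avoids213_insert_max]). Deleting the maximum is therefore a bijection
    from the avoiders of size n + 1 with maximum at index M onto the avoiders of
    size n whose first M entries increase ([card_top_at]). The latter sets
    shrink as M grows, which gives the monotonicity in M. For M = 0 and M = 1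
    they are all the avoiders of size n, while for 2 <= M <= n the decreasing
    permutation is excluded, so the maximum is attained at M = 0 and M = 1 only.

    What remains is to count avoiders. Let g(n, m) be the number of avoiders of
    size n whose first m entries increase. Splitting by the index of the maximum
    gives g(n + 1, m) = sum of g(n, i) over i >= m - 1
    ([card_incr_avoidersS]), which is solved by the ballot numbers
    C(2n - m, n) - C(2n - m, n + 1) ([card_incr_avoiders]); m = 0 yields the
    Catalan numbers. The maximal probability is thus the ratio of two
    consecutive Catalan numbers, 1/4 + 3/(4(2n - 1)), which decreases to 1/4. *)

(** * Permutations avoiding 213 *)

Definition is213 n (s : 'S_n) (i j k : 'I_n) : bool :=
  [&& (i < j)%N, (j < k)%N, (s j < s i)%N & (s i < s k)%N].

Lemma avoids213P n (s : 'S_n) :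
  reflect (forall i j k, ~~ is213 s i j k) (s \in avoiders n pat213).
Proof.
pose o0 := Ordinal (isT : (0 < 3)%N); pose o1 := Ordinal (isT : (1 < 3)%N).
pose o2 := Ordinal (isT : (2 < 3)%N).
have p0 : pat213 o0 = o1 by rewrite tpermL.
have p1 : pat213 o1 = o0 by rewrite tpermR.
have p2 : pat213 o2 = o2 by rewrite tpermD.
have o3P (x : 'I_3) : [\/ x = o0, x = o1 | x = o2].
  case: x => -[|[|[|//]]] lt_x; [apply: Or31|apply: Or32|apply: Or33];
  exact: val_inj.
rewrite inE; apply: (iffP existsPn) => [noF i j k | noT f].
  apply/negP => /and4P[ij jk sji sik].
  pose f := [ffun x : 'I_3 => if x == o0 then i else if x == o1 then j else k].
  have f0 : f o0 = i by rewrite ffunE.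
  have f1 : f o1 = j by rewrite ffunE.
  have f2 : f o2 = k by rewrite ffunE.
  case/negP: (noF f); apply/andP; split; apply/forallP=> x; apply/forallP=> y.
    by apply/implyP; case: (o3P x) => ->; case: (o3P y) => ->;
       rewrite ?f0 ?f1 ?f2 //= => _; lia.
  by case: (o3P x) => ->; case: (o3P y) => ->;
     rewrite ?f0 ?f1 ?f2 ?p0 ?p1 ?p2 /=; lia.
apply/negP => /andP[/forallP mono /forallP pat].
have m (x y : 'I_3) : (x < y)%N -> (f x < f y)%N.
  by have /forallP/(_ y)/implyP := mono x.
have p (x y : 'I_3) : (s (f x) < s (f y))%N = (pat213 x < pat213 y)%N.
  by have /forallP/(_ y)/eqP := pat x.
case/negP: (noT (f o0) (f o1) (f o2)).
by rewrite /is213 !m // !p p0 p1 p2.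
Qed.

Definition incr_prefix n (m : nat) (s : 'S_n) : bool :=
  [forall x : 'I_n, forall y : 'I_n, (x < y < m)%N ==> (s x < s y)%N].

Lemma incr_prefixP n m (s : 'S_n) :
  reflect (forall x y : 'I_n, (x < y)%N -> (y < m)%N -> (s x < s y)%N)
          (incr_prefix m s).
Proof.
apply: (iffP forallP) => [H x y xy ym | H x].
  by have /forallP/(_ y)/implyP := H x; apply; rewrite xy.
by apply/forallP=> y; apply/implyP => /andP[]; apply: H.
Qed.

Lemma incr_prefix_le1 n m (s : 'S_n) : (m <= 1)%N -> incr_prefix m s.
Proof. by move=> m1; apply/incr_prefixP => x y; lia. Qed.

Lemma incr_prefixW n m m' (s : 'S_n) :
  (m <= m')%N -> incr_prefix m' s -> incr_prefix m s.
Proof.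
move=> mm /incr_prefixP H; apply/incr_prefixP => x y xy ym.
by apply: H => //; apply: leq_trans mm.
Qed.

(** * Inserting a new maximum *)

Lemma ltn_lift n (i : 'I_n.+1) (a b : 'I_n) :
  (lift i a < lift i b)%N = (a < b)%N.
Proof. by rewrite !ltnNge leq_bump2. Qed.

Lemma lift_ltn n (i : 'I_n.+1) (a : 'I_n) : (lift i a < i)%N = (a < i)%N.
Proof. by rewrite /= /bump; case: leqP; lia. Qed.

Lemma lift_perm_max_ltn n (i : 'I_n.+1) (s : 'S_n) a b :
  (lift_perm i ord_max s (lift i a) < lift_perm i ord_max s (lift i b))%N
  = (s a < s b)%N.
Proof. by rewrite !lift_perm_lift ltn_lift. Qed.

Lemma lift_perm_max_top n (i : 'I_n.+1) (s : 'S_n) x :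
  (lift_perm i ord_max s i < lift_perm i ord_max s x)%N = false.
Proof. by rewrite lift_perm_id ltnNge leq_ord. Qed.

Lemma lift_perm_max_below n (i : 'I_n.+1) (s : 'S_n) a :
  (lift_perm i ord_max s (lift i a) < lift_perm i ord_max s i)%N.
Proof. by rewrite lift_perm_id lift_perm_lift lift_max /=. Qed.

(** The new maximum can only be the last letter of a 213, so the new
    occurrences of the pattern are the inversions among the entries before it. *)
Lemma avoids213_insert_max n (i : 'I_n.+1) (s : 'S_n) :
  (lift_perm i ord_max s \in avoiders n.+1 pat213)
  = (s \in avoiders n pat213) && incr_prefix i s.
Proof.
apply/avoids213P/andP=> [H | [/avoids213P Hs /incr_prefixP Hi] x y z].
  split.
    apply/avoids213P => a b c.
    by have := H (lift i a) (lift i b) (lift i c);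
       rewrite /is213 !ltn_lift !lift_perm_max_ltn.
  apply/incr_prefixP => a b ab bi; rewrite ltnNge; apply/negP => sba.
  have neq : s a != s b by rewrite (inj_eq perm_inj) -val_eqE /= neq_ltn ab.
  have := H (lift i a) (lift i b) i.
  rewrite /is213 ltn_lift lift_perm_max_ltn lift_ltn ab bi lift_perm_max_below.
  by rewrite ltn_neqAle eq_sym sba andbT val_eqE neq.
apply/negP => /and4P[].
case: (unliftP i x) => [a|] ->; last by rewrite lift_perm_max_top.
case: (unliftP i y) => [b|] ->; last by rewrite lift_perm_max_top.
case: (unliftP i z) => [c|] ->.
  rewrite !ltn_lift !lift_perm_max_ltn => ab bc sba sac.
  by have := Hs a b c; rewrite /is213 ab bc sba sac.
rewrite ltn_lift lift_ltn lift_perm_max_ltn => ab bi.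
by rewrite ltnNge (ltnW (Hi a b ab bi)).
Qed.

(** A prefix that extends past the maximum cannot increase; one that stops at
    the maximum (length i + 1) or earlier does, because the entries before the
    maximum already increase. *)
Lemma incr_prefix_insert_max n m (i : 'I_n.+1) (s : 'S_n) :
  (m <= n.+1)%N -> incr_prefix i s ->
  incr_prefix m (lift_perm i ord_max s) = (m <= i.+1)%N.
Proof.
move=> mn /incr_prefixP Hi; apply/incr_prefixP/idP => [H | mi x y].
  rewrite leqNgt; apply/negP => im.
  have i1 : (i.+1 < n.+1)%N by lia.
  by have := H i (Ordinal i1) (ltnSn _) im; rewrite lift_perm_max_top.
case: (unliftP i x) => [a|] ->; last by lia.
case: (unliftP i y) => [b|] ->; last by rewrite lift_perm_max_below.
rewrite ltn_lift lift_perm_max_ltn => ab bm; apply: Hi => //.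
by move: bm; rewrite /= /bump; case: leqP; lia.
Qed.

Lemma lift_perm_surj n (i j : 'I_n.+1) (s : 'S_n.+1) :
  s i = j -> exists t, s = lift_perm i j t.
Proof.
move=> sij; pose f k := odflt k (unlift j (s (lift i k))).
have fK k : lift j (f k) = s (lift i k).
  rewrite /f; case: unliftP => [k' -> //|] sk.
  by have := neq_lift i k; rewrite -(inj_eq (@perm_inj _ s)) sk sij eqxx.
have f_inj : injective f.
  by move=> a b fab; apply: (@lift_inj _ i); apply: (@perm_inj _ s);
     rewrite -!fK fab.
exists (perm f_inj); apply/permP => x.
case: (unliftP i x) => [a|] ->; last by rewrite lift_perm_id.
by rewrite lift_perm_lift permE fK.
Qed.

Lemma lift_perm_inj n (i j : 'I_n.+1) : injective (@lift_perm n i j).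
Proof.
move=> s t st; apply/permP => k; apply: (@lift_inj _ j).
by rewrite -!(lift_perm_lift i) st.
Qed.

(** Deleting the entry at index i is inverse to [lift_perm i j] on the
    permutations that send i to j. *)
Lemma card_perm_at n (i j : 'I_n.+1) (P : pred 'S_n.+1) :
  #|[set s | P s & s i == j]| = #|[set t | P (lift_perm i j t)]|.
Proof.
rewrite -(card_imset _ (@lift_perm_inj n i j)); apply: eq_card => s.
rewrite inE; apply/andP/imsetP => [[Ps /eqP sij] | [t]].
  have [t st] := lift_perm_surj sij; exists t; last exact: st.
  by rewrite inE -st.
by rewrite inE => Pt ->; rewrite lift_perm_id.
Qed.

(** * The ballot recurrence *)

Definition incr_avoiders n m : {set 'S_n} :=
  [set s in avoiders n pat213 | incr_prefix m s].

Lemma in_incr_avoiders n m (s : 'S_n) :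
  (s \in incr_avoiders n m) = (s \in avoiders n pat213) && incr_prefix m s.
Proof. exact: finset.in_set. Qed.

Lemma incr_avoiders_le1 n m : (m <= 1)%N -> incr_avoiders n m = avoiders n pat213.
Proof.
by move=> m1; apply/setP => s; rewrite !inE incr_prefix_le1 // andbT.
Qed.

(** Once the maximum, at index M, is deleted, avoidance of the original
    permutation leaves the increasing prefix of length M as its only trace. *)
Lemma card_top_at n (M : 'I_n.+1) :
  #|avoiders n.+1 pat213 :&: top_at M| = #|incr_avoiders n M|.
Proof.
transitivity #|[set s | s \in avoiders n.+1 pat213 & s M == ord_max]|.
  by apply: eq_card => s; rewrite !inE.
rewrite card_perm_at; apply: eq_card => s.
by rewrite finset.in_set in_incr_avoiders avoids213_insert_max.
Qed.

(** Classify by the index i of the maximum: the entries before it increase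
    anyway, so the prefix condition only says that it is not interrupted by the
    maximum, that is m <= i + 1. *)
Lemma card_incr_avoidersS n m : (m <= n.+1)%N ->
  #|incr_avoiders n.+1 m| = (\sum_(i < n.+1 | m <= i.+1) #|incr_avoiders n i|)%N.
Proof.
move=> mn; rewrite -sum1_card.
rewrite (partition_big (fun s : 'S_n.+1 => (s^-1)%g ord_max) predT) //=.
rewrite [RHS]big_mkcond; apply: eq_bigr => i _.
transitivity #|[set s | s \in incr_avoiders n.+1 m & s i == ord_max]|.
  rewrite -sum1_card; apply: eq_bigl => s; rewrite !inE.
  by rewrite (can2_eq (permKV s) (permK s)) eq_sym.
rewrite card_perm_at; have H t :
    (lift_perm i ord_max t \in incr_avoiders n.+1 m)
    = (t \in incr_avoiders n i) && (m <= i.+1)%N.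
  rewrite !in_incr_avoiders avoids213_insert_max.
  case: (boolP (incr_prefix i t)) => [it|]; last by rewrite !andbF.
  by rewrite incr_prefix_insert_max.
case: leqP => mi; last first.
  by apply: eq_card0 => t; rewrite finset.in_set H leqNgt mi andbF.
by apply: eq_card => t; rewrite finset.in_set H mi andbT.
Qed.

(** The ballot numbers C(2n - m, n) - C(2n - m, n + 1), written without
    subtraction. Two applications of Pascal's rule make their sum over the
    tail i >= m of a row telescope to the entry m + 1 of the next row. *)
Lemma card_incr_avoiders n m : (m <= n)%N ->
  (#|incr_avoiders n m| + 'C(2 * n - m, n.+1))%N = 'C(2 * n - m, n).
Proof.
elim: n m => [m | n IHn].
  rewrite leqn0 => /eqP ->; rewrite muln0 sub0n bin0 bin_small // addn0.
  rewrite incr_avoiders_le1 // (_ : avoiders _ _ = [set: 'S_0]); last first.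
    by apply/setP => s; rewrite finset.in_setT; apply/avoids213P => -[].
  by rewrite cardsT card_Sn.
have tail m : (m <= n.+1)%N ->
    (\sum_(m <= i < n.+1) #|incr_avoiders n i| + 'C((2 * n).+1 - m, n.+2))%N
    = 'C((2 * n).+1 - m, n.+1).
  move=> mn; rewrite -(subKn mn); elim: (n.+1 - m)%N (leq_subr m n.+1).
    by move=> _; rewrite subn0 big_geq // !bin_small //; lia.
  move=> d IHd dn; have {}IHd := IHd (ltnW dn).
  rewrite big_ltn; last by lia.
  rewrite (_ : (n.+1 - d.+1).+1 = n.+1 - d)%N; last by lia.
  rewrite (_ : (2 * n).+1 - (n.+1 - d.+1) = ((2 * n).+1 - (n.+1 - d)).+1)%N;
    last by lia.
  have := IHn (n.+1 - d.+1)%N _.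
  rewrite (_ : 2 * n - (n.+1 - d.+1) = (2 * n).+1 - (n.+1 - d))%N; last by lia.
  by rewrite !binS -IHd; lia.
have pos m : (m <= n)%N ->
    (#|incr_avoiders n.+1 m.+1| + 'C(2 * n.+1 - m.+1, n.+2))%N
    = 'C(2 * n.+1 - m.+1, n.+1).
  move=> mn; rewrite card_incr_avoidersS //.
  rewrite -(big_mkord (fun i => m < i.+1)%N (fun i => #|incr_avoiders n i|)).
  rewrite (_ : 2 * n.+1 - m.+1 = (2 * n).+1 - m)%N; last by lia.
  rewrite -tail; last by lia.
  by congr (_ + _)%N; rewrite (big_nat_widenl m 0).
case=> [_|m mn]; last exact: pos.
(* A prefix of length 0 or 1 is always increasing, so the first two entries of
   a row agree; on binomials this is the symmetry of row 2n + 1. *)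
have := pos 0%N isT; rewrite !incr_avoiders_le1 //.
rewrite !subn0 (_ : 2 * n.+1 - 1 = (2 * n).+1)%N; last by lia.
rewrite (_ : 2 * n.+1 = (2 * n).+2)%N; last by lia.
rewrite (binS (2 * n).+1 n.+1) (binS (2 * n).+1 n) => e.
rewrite -[in RHS](bin_sub (m := n)); last by lia.
by rewrite (_ : (2 * n).+1 - n = n.+1)%N; lia.
Qed.

(** Entry m = 0 of the ballot triangle: C(2n, n) - C(2n, n + 1) is the Catalan
    number C(2n, n) / (n + 1). *)
Lemma card_avoiders213 n : (n.+1 * #|avoiders n pat213|)%N = 'C(2 * n, n).
Proof.
have := card_incr_avoiders (leq0n n); rewrite incr_avoiders_le1 // subn0 => e.
have := mul_bin_left (2 * n) n; rewrite (_ : 2 * n - n = n)%N; last by lia.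
by move: e; nia.
Qed.

Lemma incr_avoiders_sub n m m' : (m <= m')%N ->
  incr_avoiders n m' \subset incr_avoiders n m.
Proof.
move=> mm; apply/fintype.subsetP => s; rewrite !in_incr_avoiders => /andP[-> /=].
exact: incr_prefixW.
Qed.

(** The decreasing permutation avoids 213 but starts with a descent. *)
Lemma card_incr_avoiders_lt n m : (2 <= n)%N -> (2 <= m)%N ->
  (#|incr_avoiders n m| < #|avoiders n pat213|)%N.
Proof.
move=> n2 m2; rewrite -(@incr_avoiders_le1 n 0) //; apply: proper_card.
apply/fintype.properP; split; first exact: incr_avoiders_sub.
exists (perm (@rev_ord_inj n)).
  rewrite incr_avoiders_le1 //; apply/avoids213P => i j k; apply/negP.
  by rewrite /is213 !permE /= => /and4P[]; lia.
rewrite in_incr_avoiders negb_and; apply/orP; right; apply/negP.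
move=> /incr_prefixP/(_ (Ordinal (ltnW n2)) (Ordinal n2) isT m2).
by rewrite !permE /=; lia.
Qed.

(** * Winning means that the maximum comes right after the rejected items *)

(** If the maximum stood at an index i > M, then M itself would be acceptable:
    an earlier entry exceeding the one at M would form a 213 with M and i. *)
Lemma win_top_at n (M : 'I_n.+1) (s : 'S_n.+1) : s \in avoiders n.+1 pat213 ->
  (s \in win n.+1 M) = (s \in top_at M).
Proof.
move=> /avoids213P avs; rewrite !inE /=; apply/existsP/eqP => [|sM].
  move=> [i /andP[/andP[/andP[Mi /forallP below] /forallP first]] /eqP si].
  have [Mlt|iM] := ltnP M i; last first.
    by rewrite (_ : M = i) //; apply: val_inj => /=; lia.
  have /implyP/(_ Mlt)/negP[] := first M.
  rewrite /acceptable leqnn; apply/forallP => j; apply/implyP => jM.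
  rewrite ltnNge leq_eqVlt negb_or; apply/andP; split.
    by rewrite val_eqE (inj_eq perm_inj) -val_eqE /=; lia.
  apply/negP => sMj; case/negP: (avs j M i).
  by rewrite /is213 jM Mlt sMj; have /implyP/(_ jM) := below j.
exists M; rewrite sM eqxx andbT; apply/andP; split.
  rewrite /acceptable leqnn; apply/forallP => j; apply/implyP => jM.
  have : s j != s M by rewrite (inj_eq perm_inj) -val_eqE /=; lia.
  by rewrite -val_eqE /= sM; have := leq_ord (s j); lia.
by apply/forallP => k; apply/implyP => kM; rewrite /acceptable leqNgt kM.
Qed.

(** * Probabilities *)

Local Open Scope ring_scope.

Section Probabilities.
Variable R : realType.

Lemma prob_win n (M : 'I_n) :
  prob_av R pat213 (win n M) = prob_av R pat213 (top_at M).
Proof.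
case: n M => [[] //|n M]; rewrite /prob_av; congr (_%:R / _).
apply: eq_card => s; rewrite !finset.in_setI; apply: andb_id2l.
exact: win_top_at.
Qed.

Lemma catalanE n : catalan R n = #|avoiders n pat213|%:R.
Proof.
by rewrite /catalan -card_avoiders213 natrM mulrC mulKf // pnatr_eq0.
Qed.

Lemma catalan_gt0 n : 0 < catalan R n.
Proof. by rewrite divr_gt0 ?ltr0n // bin_gt0; lia. Qed.

Lemma catalan_ratio n :
  catalan R n / catalan R n.+1 = (n.+1%:R + 1) / (2 * (2 * n.+1%:R - 1)).
Proof.
(* the recurrence of the central binomial coefficients *)
have bin_step : (n.+1 * 'C(2 * n.+1, n.+1) = 2 * (2 * n).+1 * 'C(2 * n, n))%N.
  have := mul_bin_diag (2 * n).+2 n; have := mul_bin_down (2 * n).+1 n.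
  rewrite /= (_ : 2 * n.+1 = (2 * n).+2)%N; last by lia.
  rewrite (_ : (2 * n).+1 - n = n.+1)%N; last by lia.
  by nia.
have b_gt0 : (0 < 'C(2 * n, n))%N by rewrite bin_gt0; lia.
have /(congr1 (fun k => k%:R : R)) := bin_step; rewrite !natrM => e.
have eB : 'C(2 * n.+1, n.+1)%:R
        = 2 * (2 * n).+1%:R * 'C(2 * n, n)%:R / n.+1%:R :> R.
  by rewrite -e mulrC mulKf // pnatr_eq0.
rewrite /catalan eB.
have n1 : 2 * n.+1%:R - 1 = (2 * n).+1%:R :> R by rewrite -!natr1 natrM; ring.
rewrite n1 natr1; field.
have n0 : 0 <= n%:R :> R := ler0n R n.
by apply/and4P; split; apply: lt0r_neq0; rewrite ?ltr0n //; lra.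
Qed.

Lemma prob_top_at n (M : 'I_n.+1) :
  prob_av R pat213 (top_at M) = #|incr_avoiders n M|%:R / catalan R n.+1.
Proof. by rewrite /prob_av card_top_at catalanE. Qed.

Lemma prob_top_at_le1 n (M : 'I_n.+1) : (M <= 1)%N ->
  prob_av R pat213 (top_at M) = catalan R n / catalan R n.+1.
Proof. by move=> M1; rewrite prob_top_at incr_avoiders_le1 // -catalanE. Qed.

Lemma prob_top_at_mono n (M M' : 'I_n) : (M <= M')%N ->
  prob_av R pat213 (top_at M') <= prob_av R pat213 (top_at M).
Proof.
case: n M M' => [[] //|n M M' MM]; rewrite !prob_top_at.
rewrite ler_pM2r ?invr_gt0 ?catalan_gt0 // ler_nat.
exact/subset_leq_card/incr_avoiders_sub.
Qed.

Lemma prob_top_at_lt n (M : 'I_n.+1) : (2 <= M)%N ->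
  prob_av R pat213 (top_at M) < catalan R n / catalan R n.+1.
Proof.
move=> M2; rewrite prob_top_at ltr_pM2r ?invr_gt0 ?catalan_gt0 //.
rewrite catalanE ltr_nat card_incr_avoiders_lt //.
by have := ltn_ord M; lia.
Qed.

Lemma prob_win_le1 n M : (M <= 1)%N -> (M <= n)%N ->
  prob_av R pat213 (win n.+1 M) = catalan R n / catalan R n.+1.
Proof.
move=> M1 Mn; rewrite -(@prob_top_at_le1 n (Ordinal (Mn : M < n.+1)%N)) //.
by rewrite -prob_win.
Qed.

Lemma optimal_prob213 n :
  optimal_prob R n.+1 pat213 = catalan R n / catalan R n.+1.
Proof.
apply/le_anti/andP; split.
  apply/bigmax_leP; split; first by rewrite divr_ge0 // ltW // catalan_gt0.
  move=> M _; rewrite prob_win -(@prob_top_at_le1 n ord0) //.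
  exact: prob_top_at_mono.
rewrite -(@prob_win_le1 n 0) //.
exact: (le_bigmax 0 (fun M : 'I_n.+1 => prob_av R pat213 (win n.+1 M)) ord0).
Qed.

Lemma cvg_catalan_ratio :
  ((fun n => catalan R n / catalan R n.+1) @ \oo --> (1 / 4 : R))%classic.
Proof.
have -> : (fun n => catalan R n / catalan R n.+1)
        = (fun n => 1 / 4 + 3 / (4 * (2 * n.+1%:R - 1)) : R).
  apply/funext => n; rewrite catalan_ratio; field.
  by apply: lt0r_neq0; have := ler0n R n; lra.
(* 0 <= 3 / (4 (2n + 1)) <= 3 / (4 (n + 1)) *)
apply: (@squeeze_cvgr _ _ _ _ (fun=> 1 / 4)
                                (fun n => 1 / 4 + 3 / 4 * n.+1%:R^-1)).
- near=> n; have n0 : 1 <= n.+1%:R :> R by rewrite ler1n.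
  apply/andP; split; first by rewrite lerDl; apply: divr_ge0; lra.
  rewrite lerD2l -mulrA ler_pM2l // -invfM lef_pV2 ?posrE; lra.
- exact: cvg_cst.
- have lim : ((1 / 4 + 3 / 4 * n.+1%:R^-1 : R) @[n --> \oo]
              --> (1 / 4 + 3 / 4 * 0 : R))%classic.
    apply: cvgD; first exact: cvg_cst.
    by apply: cvgM; [exact: cvg_cst | exact: cvg_harmonic].
  by rewrite mulr0 addr0 in lim.
Unshelve. all: by end_near.
Qed.

Lemma cvg_prob_win_le1 M : (M <= 1)%N ->
  ((fun n => prob_av R pat213 (win n M)) @ \oo --> (1 / 4 : R))%classic.
Proof.
(* For M = 1 the size must be at least 2, whence the shift by two. *)
move=> M1; have eq_ratio n :
    prob_av R pat213 (win n.+2 M) = catalan R n.+1 / catalan R n.+2.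
  by apply: prob_win_le1 => //; apply: leq_trans M1 _.
have lim :
    ((fun n => catalan R n.+1 / catalan R n.+2) @ \oo --> (1 / 4 : R))%classic.
  by have := cvg_catalan_ratio; rewrite -cvg_shiftS.
by rewrite -(funext eq_ratio) in lim; rewrite -2!cvg_shiftS.
Qed.

End Probabilities.

Local Open Scope classical_set_scope.

Theorem proposition3 (R : realType) :
  (forall n : nat, (3 <= n)%N ->
    (forall M : 'I_n,
       prob_av R pat213 (win n M) = prob_av R pat213 (top_at M)) /\
    (forall M M' : 'I_n, (M <= M')%N ->
       prob_av R pat213 (top_at M') <= prob_av R pat213 (top_at M)) /\
    (forall M : 'I_n,
       (forall M' : 'I_n,
          prob_av R pat213 (top_at M') <= prob_av R pat213 (top_at M)) <->
       (M = 0%N :> nat \/ M = 1%N :> nat)) /\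
    prob_av R pat213 (win n 0) = prob_av R pat213 (win n 1) /\
    prob_av R pat213 (win n 1) = catalan R n.-1 / catalan R n /\
    catalan R n.-1 / catalan R n = (n%:R + 1) / (2 * (2 * n%:R - 1))) /\
  (forall n m : nat, (3 <= n)%N -> (n < m)%N ->
     optimal_prob R m pat213 < optimal_prob R n pat213) /\
  ((fun n : nat => prob_av R pat213 (win n 0)) @ \oo --> (1 / 4 : R)) /\
  ((fun n : nat => prob_av R pat213 (win n 1)) @ \oo --> (1 / 4 : R)).
Proof.
have at_succ (n M : nat) : (3 <= n)%N -> (M <= 1)%N ->
    prob_av R pat213 (win n M) = catalan R n.-1 / catalan R n.
  by case: n => // n n3 M1; apply: prob_win_le1; lia.
split; [|split; [|split]].
- case=> // n n3; split; [|split; [|split; [|split; [|split]]]].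
  + exact: prob_win.
  + exact: prob_top_at_mono.
  + move=> M; split=> [maxM | M01 M'].
      have [|M2] := leqP M 1; first by move: (nat_of_ord M) => [|[|]]; auto.
      by have := maxM ord0; rewrite prob_top_at_le1 // leNgt prob_top_at_lt.
    rewrite (@prob_top_at_le1 _ _ M); last by case: M01 => ->.
    by rewrite -(@prob_top_at_le1 _ _ ord0) //; exact: prob_top_at_mono.
  + by rewrite !at_succ.
  + exact: at_succ.
  + exact: catalan_ratio.
- move=> [|n] // [|m] // n3 nm; rewrite !optimal_prob213 !catalan_ratio.
  have n1 : 1 <= n.+1%:R :> R by rewrite ler1n.
  have lt : n.+1%:R < m.+1%:R :> R by rewrite ltr_nat.
  rewrite ltr_pdivrMr; last by lra.
  by rewrite mulrAC ltr_pdivlMr; lra.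
- exact: cvg_prob_win_le1.
- exact: cvg_prob_win_le1.
Qed.
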